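(* For every integer $d\geq 2$ we have \[N(d)\geq \left\lceil\frac{1}{1089}\left(32d^2+328d+296\right)\right\rceil.\]
   Context: A set of $n$ (distinct) lines through the origin in Euclidean space $\mathbb{R}^d$, represented by unit vectors $v_1,\dots,v_n$, is called equiangular if there is a constant $\alpha\geq 0$ (the common angle) such that $\langle v_i,v_j\rangle=\pm\alpha$ for all $1\leq i<j\leq n$. $N(d)$ denotes the maximum number of equiangular lines in $\mathbb{R}^d$. *)

(* Defs.v *)
From mathcomp Require Import all_boot all_order all_algebra.
From mathcomp Require Import boolp reals.
From mathcomp Require Import ring lra.
Set Implicit Arguments.
Unset Strict Implicit.
Unset Printing Implicit Defensive.
Import Order.TTheory GRing.Theory Num.Theory.
Local Open Scope ring_scope.

Definition dot (R : realType) (d : nat) (u v : 'rV[R]_d) : R :=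
  \sum_(k < d) u 0 k * v 0 k.

(* The i-th line is the subspace <[v i]>; injectivity says that the n lines
   are pairwise distinct, i.e. v i <> +/- v j for i <> j. *)
Definition equiangular (R : realType) (d n : nat) (v : 'I_n -> 'rV[R]_d)
    : Prop :=
  [/\ forall i : 'I_n, dot (v i) (v i) = 1,
      injective (fun i : 'I_n => <[v i]>%VS) &
      exists2 alpha : R, 0 <= alpha &
        forall i j : 'I_n, (i < j)%N ->
          dot (v i) (v j) = alpha \/ dot (v i) (v j) = - alpha].

Definition has_equiangular (R : realType) (d n : nat) : bool :=
  `[< exists v : 'I_n -> 'rV[R]_d, equiangular v >].

Lemma has_equiangular0 (R : realType) (d : nat) :
  exists n, has_equiangular R d n.
Proof.
exists 0; apply/asboolP; exists (fun=> 0).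
by split=> [[]|[]|] //; exists 0 => // -[].
Qed.

Lemma dotC (R : realType) (d : nat) (u v : 'rV[R]_d) : dot u v = dot v u.
Proof. by apply: eq_bigr => k _; rewrite mulrC. Qed.

Lemma dotB (R : realType) (d : nat) (u v : 'rV[R]_d) (a : R) :
  dot (u - a *: v) (u - a *: v)
  = dot u u - 2 * a * dot u v + a ^+ 2 * dot v v.
Proof.
rewrite /dot !mulr_sumr -sumrB -big_split /=; apply: eq_bigr => k _.
by rewrite !mxE; ring.
Qed.

Lemma dot_ge0 (R : realType) (d : nat) (u : 'rV[R]_d) : 0 <= dot u u.
Proof. by apply: sumr_ge0 => k _; rewrite -expr2 sqr_ge0. Qed.

Lemma dot_eq0 (R : realType) (d : nat) (u : 'rV[R]_d) : dot u u = 0 -> u = 0.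
Proof.
move=> u0; apply/rowP => k; rewrite mxE; apply/eqP; rewrite -sqrf_eq0 expr2.
apply/eqP; apply: (psumr_eq0P _ u0) => // i _.
by rewrite -expr2 sqr_ge0.
Qed.

Lemma dot_lt1 (R : realType) (d : nat) (u v : 'rV[R]_d) :
  dot u u = 1 -> dot v v = 1 -> <[u]>%VS != <[v]>%VS -> dot u v ^+ 2 < 1.
Proof.
move=> u1 v1 uv; pose a := dot u v.
have E := dotB u v a; rewrite u1 v1 -/a in E.
rewrite -/a ltNge; apply/negP => a1.
have w0 : dot (u - a *: v) (u - a *: v) = 0.
  by apply/eqP; rewrite eq_le dot_ge0 andbT E; nra.
have /eqP := dot_eq0 w0; rewrite subr_eq0 => /eqP ua.
have a0 : a != 0 by apply: contraTneq a1 => ->; rewrite expr0n /= -ltNge ltr01.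
have uv_line : (<[u]> <= <[v]>)%VS.
  by rewrite -memvE; apply/vlineP; exists a.
case/eqP: uv; apply/eqP; rewrite eqEsubv uv_line -memvE; apply/vlineP.
by exists a^-1; rewrite ua scalerA mulVf // scale1r.
Qed.

(* Crude form of Gerzon's bound, so that the maximum number of equiangular
   lines exists: the projections v i^T v i are linearly independent. *)
Lemma has_equiangular_bound (R : realType) (d n : nat) :
  has_equiangular R d n -> (n <= (d * d).+1)%N.
Proof.
case: n => [|[|n]] // /asboolP[v [v1 vinj [alpha _ valpha]]].
have sq i j : i != j -> dot (v i) (v j) ^+ 2 = alpha ^+ 2.
  rewrite -(inj_eq val_inj) /= neq_ltn => /orP[] /valpha.
    by case=> ->; rewrite ?sqrrN.
  by rewrite dotC; case=> ->; rewrite ?sqrrN.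
have alt1 : alpha ^+ 2 < 1.
  have ne : (ord0 : 'I_n.+2) != ord_max by [].
  by rewrite -(sq _ _ ne); apply: dot_lt1 => //; rewrite (inj_eq vinj).
pose f (p : 'I_(d * d)) := enum_val (cast_ord (esym (mxvec_cast d d)) p).
pose M : 'M[R]_(n.+2, d * d) := \matrix_i mxvec ((v i)^T *m v i).
suff /eqP Mfree : row_free M by apply: leqW; rewrite -Mfree rank_leq_col.
apply/inj_row_free => u uM0.
have MMT : M *m M^T = (1 - alpha ^+ 2)%:M + const_mx (alpha ^+ 2).
  apply/matrixP => i j; rewrite !mxE.
  have -> : \sum_k M i k * M^T k j = dot (v i) (v j) ^+ 2.
    rewrite (reindex _ (curry_mxvec_bij d d)) /=.
    rewrite expr2 /dot big_distrlr /= pair_big /=.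
    apply: eq_bigr => -[a b] _ /=; rewrite !mxE !mxvecE !mxE !big_ord1 !mxE.
    by ring.
  have [<-|ij] := eqVneq i j; first by rewrite v1 mulr1n; ring.
  by rewrite sq // mulr0n add0r.
have S0 : dot u u * (1 - alpha ^+ 2) + alpha ^+ 2 * (\sum_i u 0 i) ^+ 2 = 0.
  have : (u *m (M *m M^T) *m u^T) 0 0 = 0 by rewrite mulmxA uM0 !mul0mx mxE.
  rewrite MMT mulmxDr mulmxDl mul_mx_scalar -scalemxAl !mxE => E0; rewrite -[RHS]E0 {E0}.
  congr (_ + _).
    by rewrite mulrC; congr (_ * _); apply: eq_bigr => k _; rewrite mxE.
  rewrite [X in _ * X]expr2 mulrA [LHS]mulr_sumr; apply: eq_bigr => k _.
  rewrite !mxE mulr_sumr; congr (_ * _); apply: eq_bigr => l _.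
  by rewrite mxE mulrC.
apply: dot_eq0; apply/eqP; rewrite eq_le dot_ge0 andbT.
have := sqr_ge0 (\sum_i u 0 i); have := sqr_ge0 alpha.
have := dot_ge0 u; move: S0 alt1.
move: (dot u u) (\sum_i _) (alpha ^+ 2) => x y z E z1 x0 z0 yy.
have zy := mulr_ge0 z0 yy.
rewrite -(pmulr_lle0 _ (_ : 0 < 1 - z)); lra.
Qed.

Definition max_equiangular (R : realType) (d : nat) : nat :=
  ex_maxn (has_equiangular0 R d) (@has_equiangular_bound R d).

(* Main.v *)
Require Import Defs.
From mathcomp Require Import all_boot all_order all_algebra all_field.
From mathcomp Require Import boolp reals.
From mathcomp Require Import zify ring lra.
Import Order.TTheory GRing.Theory Num.Theory.
Set Implicit Arguments.
Unset Strict Implicit.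
Unset Printing Implicit Defensive.
Local Open Scope ring_scope.

(** The lines come from large families of mutually unbiased bases (MUBs), that
    is, orthonormal bases of a Euclidean space of dimension [M] such that
    vectors of different bases have inner product [+/- 1 / sqrt M].  If one
    extra coordinate is added for each basis, and every vector of a basis gets
    the same entry [M ^ (-1/4)] in the coordinate of that basis, then inner
    products inside a basis change from [0] to [1 / sqrt M], and the lines
    become equiangular.  So [j] bases give [j * M] lines in dimension [M + j]
    ([equiangular_of_mub]).  If a further vector [x] is unbiased to all bases,
    then, after changes of sign, all vectors have the same inner product with
    [x], so the lines lie in a hyperplane and fit in dimension [M + j - 1]
    ([equiangular_of_mub_codim1]).

    For [M = 4 ^ k] there are [M / 2 + 1] real MUBs: the standard basis,
    and one basis of sign vectors for each element of a Kerdock set of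
    [M / 2] quadratic forms over the field with two elements, any two of which
    differ by a form with nondegenerate polarization.  The classical set is
    indexed by [a] in [F = GF(2 ^ (2 k - 1))] and lives on [F * GF(2)]:
    [Q_a (x, y) = Tr (sum_(1 <= i < k) (a x) ^ (2 ^ i + 1) + y a x)].
    The polar form of [Q_a] is computed from [trace_kerdock_polar], and
    nondegeneracy is [kerdock_nondegenerate].

    Put [g d = (32 d ^ 2 + 328 d + 296) / 1089], which factors as
    [8 (d + 1) (4 d + 37) / 1089].  For [d <= 23] an orthonormal basis already
    has [g d] elements or more.  Otherwise let [M = 4 ^ k] be the power of [4]
    with [33 M / 32 <= d < 33 M / 8].  For [d + 1 <= 3 M / 2] the hyperplane
    construction with [j = d + 1 - M] bases is used; for [d = 3 M / 2] the same
    one with [j = M / 2]; and for larger [d] all [M / 2 + 1] bases are.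
    The last count, [M (M / 2 + 1)], must serve until the next power of [4]
    takes over, and it equals [g d] exactly at [d = 33 M / 8 - 1]: this is
    where the constants of [g] come from. *)

(** * Trace and quadratic forms over the field with [2 ^ (2 r + 1)] elements *)

Section Trace.

Variables (F : finFieldType) (r : nat).
Hypotheses (F2 : 2%N \in [pchar F]) (cardF : #|F| = (2 ^ r.*2.+1)%N).

Definition trace (x : F) : F := \sum_(0 <= k < r.*2.+1) x ^+ (2 ^ k).

Lemma pow2_expD k (x y : F) : (x + y) ^+ (2 ^ k) = x ^+ (2 ^ k) + y ^+ (2 ^ k).
Proof.
by apply: exprDn_pchar; rewrite pnatX (eq_pnat _ (pcharf_eq F2)) pnat_id.
Qed.

Lemma traceD x y : trace (x + y) = trace x + trace y.
Proof. by rewrite -big_split; apply: eq_bigr => k _; apply: pow2_expD. Qed.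

Lemma trace0 : trace 0 = 0.
Proof. by rewrite /trace big1 // => k _; rewrite expr0n expn_eq0. Qed.

Lemma trace_sum m n (f : nat -> F) :
  trace (\sum_(m <= k < n) f k) = \sum_(m <= k < n) trace (f k).
Proof. by apply: (big_morph trace traceD trace0). Qed.

Lemma trace_sqr x : trace (x ^+ 2) = trace x.
Proof.
rewrite /trace [RHS]big_nat_recl // [LHS]big_nat_recr //= addrC.
rewrite -exprM -expnS -cardF expf_card expr1; congr (_ + _).
by apply: eq_bigr => k _; rewrite -exprM -expnS.
Qed.

Lemma trace_pow2 k x : trace (x ^+ (2 ^ k)) = trace x.
Proof.
by elim: k => [|k IHk]; rewrite ?expr1 // expnSr exprM trace_sqr.
Qed.

Lemma sqr_trace x : trace x ^+ 2 = trace x.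
Proof.
rewrite -[RHS]trace_sqr /trace.
elim: r.*2.+1 => [|n IHn]; first by rewrite !big_nil expr0n.
by rewrite !big_nat_recr //= (pow2_expD 1) IHn -!exprM mulnC.
Qed.

(** The odd degree of [F] over its prime field enters here: the trace restricts
    to the identity of the prime field, hence is nonzero. *)
Lemma trace_fixed s : s ^+ 2 = s -> trace s = s.
Proof.
move=> ss; have sk k : s ^+ (2 ^ k) = s.
  by elim: k => [|k IHk]; rewrite ?expr1 // expnSr exprM IHk.
rewrite /trace (eq_bigr (fun=> s)) // sumr_const_nat subn0 mulrS -mul2n.
by rewrite mulrnA mulr2n addrr_pchar2 // mul0rn addr0.
Qed.

Lemma trace1 : trace 1 = 1.
Proof. by apply: trace_fixed; rewrite expr1n. Qed.

Lemma traceZ s x : s ^+ 2 = s -> trace (s * x) = s * trace x.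
Proof.
move=> ss; rewrite /trace mulr_sumr; apply: eq_bigr => k _; rewrite exprMn.
by congr (_ * _); elim: k => [|k IHk]; rewrite ?expr1 // expnSr exprM IHk.
Qed.

Lemma bool_sqr (b : bool) : (b%:R : F) ^+ 2 = b%:R.
Proof. by case: b; rewrite ?expr1n ?expr0n. Qed.

(** The trace of [kerdock_form] is the quadratic form whose polarization is
    [Tr (x z) + Tr x Tr z]; the sum stops halfway because the two terms
    [x ^ (2 ^ k) z] and [x z ^ (2 ^ k)] of the polarization have traces that
    account for the Frobenius exponents [k] and [2 r + 1 - k]. *)
Definition kerdock_form (x : F) : F := \sum_(1 <= k < r.+1) x ^+ (2 ^ k).+1.

Definition kerdock_polar (x z : F) : F :=
  \sum_(1 <= k < r.+1) (x ^+ (2 ^ k) * z + x * z ^+ (2 ^ k)).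

Lemma kerdock_formD x z :
  kerdock_form (x + z) = kerdock_form x + kerdock_form z + kerdock_polar x z.
Proof.
rewrite /kerdock_form -!big_split; apply: eq_bigr => k _ /=.
by rewrite !exprSr pow2_expD; ring.
Qed.

(** Applying a power of Frobenius moves it from [z] to [x] under the trace, so
    that the traces of [x ^ (2 ^ k) z] for all [0 < k < 2 r + 1] appear; they
    are what is missing from [Tr (x z)] to make [Tr (Tr x * z)]. *)
Lemma trace_kerdock_polar x z :
  trace (kerdock_polar x z) = trace (x * z) + trace x * trace z.
Proof.
have tail : \sum_(1 <= k < r.+1) trace (x * z ^+ (2 ^ k)) =
    \sum_(r.+1 <= k < r.*2.+1) trace (x ^+ (2 ^ k) * z).
  rewrite big_nat_rev /= -[r.+1 in RHS]add1n big_addn -addnn subSn ?leq_addl //.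
  rewrite addnK; apply: eq_big_nat => k /andP[k1 kr].
  rewrite -(trace_pow2 (k + r)) exprMn -exprM -expnD.
  have -> : (1 + r.+1 - k.+1 + (k + r) = r.*2.+1)%N by lia.
  by rewrite -cardF expf_card.
rewrite /kerdock_polar trace_sum.
under eq_bigr do rewrite traceD.
rewrite big_split /= tail -big_cat_nat ?ltnS -?addnn ?leq_addr //=.
rewrite -trace_sum -mulr_suml -(traceZ _ (sqr_trace x)) -traceD -mulrDl addnn.
congr (trace (_ * z)); rewrite [X in _ + X]/trace [in RHS]big_ltn //.
by rewrite addrA expr1 addrr_pchar2 // add0r.
Qed.

(** * Signs and character sums *)

(* Vectors of [F * GF(2)] are pairs in [F * bool], added with exclusive or in
   the second component; [natr_addb] embeds that component into [F]. *)

Variable R : numDomainType.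

(** The nontrivial additive character [(-1) ^ Tr x], with values in [R]. *)
Definition chi (x : F) : R := if trace x == 0 then 1 else -1.

Lemma trace_bool x : trace x = 0 \/ trace x = 1.
Proof.
have /eqP := sqr_trace x; rewrite expr2 -subr_eq0 -{3}[trace x]mulr1 -mulrBr.
by rewrite mulf_eq0 subr_eq0 => /orP[] /eqP ->; [left | right].
Qed.

Lemma chiD x y : chi (x + y) = chi x * chi y.
Proof.
rewrite /chi traceD; case: (trace_bool x) (trace_bool y) => -> [] ->;
  rewrite ?addr0 ?add0r ?addrr_pchar2 ?eqxx ?oner_eq0 //; ring.
Qed.

Lemma chi0 : chi 0 = 1. Proof. by rewrite /chi trace0 eqxx. Qed.

Lemma chi_neq0 x : trace x != 0 -> chi x = -1.
Proof. by rewrite /chi => /negPf ->. Qed.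

Lemma chi_sqr x : chi x ^+ 2 = 1.
Proof. by rewrite expr2 -chiD addrr_pchar2 // chi0. Qed.

Lemma eq_chi x y : trace x = trace y -> chi x = chi y.
Proof. by rewrite /chi => ->. Qed.

Notation V := (F * bool)%type.

Definition pairing (p t : F) (w : V) : F := p * w.1 + t * w.2%:R.

Lemma natr_addb (b c : bool) : ((b + c)%R : bool)%:R = b%:R + c%:R :> F.
Proof. by case: b c => -[] //=; rewrite ?addr0 ?add0r // addrr_pchar2. Qed.

Lemma pairingD p t w h : pairing p t (w + h) = pairing p t w + pairing p t h.
Proof. by rewrite /pairing /= natr_addb; ring. Qed.

(** A character that takes the value [-1] sums to zero: translating the
    summation variable changes the sign of the sum. *)
Lemma sum_chi_pairing p t : (p != 0) || (trace t != 0) ->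
  \sum_(w : V) chi (pairing p t w) = 0 :> R.
Proof.
move=> pt; have [h hh] : exists h, chi (pairing p t h) = -1.
  have [p0|p0] := eqVneq p 0.
    move: pt; rewrite p0 eqxx => /= /chi_neq0 t1.
    by exists (0, true); rewrite /pairing /= mulr0 add0r mulr1.
  exists (p^-1, false); rewrite /pairing /= mulr0 addr0 mulfV //.
  by rewrite chi_neq0 // trace1 oner_eq0.
set S := \sum_w _; have SN : S = - S.
  rewrite {1}/S (reindex_inj (addrI h)) -mulN1r -hh mulr_sumr.
  by apply: eq_bigr => w _; rewrite pairingD chiD.
have : S *+ 2 == 0 by rewrite mulr2n {1}SN addNr.
by rewrite mulrn_eq0 => /eqP.
Qed.

(** * Unbiased bases from the Kerdock set *)

(** The bases are indexed by [a], and [u] runs over the linear forms added to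
    the quadratic form, hence over the vectors of the basis.  The entries are
    signs, so the vectors have squared norm [#|V|]. *)
Definition kerdock_vec (a : F) (u w : V) : R :=
  chi (kerdock_form (a * w.1) + a * w.1 * w.2%:R + pairing u.1 u.2%:R w).

(** The polar form of [Q_a], with [h] fixed, is the linear form
    [w |-> Tr (pairing (polar_dual a h) (a * h.1) w)]. *)
Definition polar_dual (a : F) (h : V) : F :=
  a * (a * h.1 + trace (a * h.1) + h.2%:R).

Lemma kerdock_vecD a u w h :
  kerdock_vec a u (w + h) =
  kerdock_vec a u w * kerdock_vec a u h
    * chi (pairing (polar_dual a h) (a * h.1) w).
Proof.
rewrite /kerdock_vec -!chiD; apply: eq_chi.
rewrite pairingD /= mulrDr kerdock_formD natr_addb.
set x := a * w.1; set z := a * h.1.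
have -> : pairing (polar_dual a h) z w =
    x * z + trace z * x + x * h.2%:R + z * w.2%:R.
  by rewrite /pairing /polar_dual /x /z; ring.
have zz := traceZ x (sqr_trace z).
rewrite !mulrDl !mulrDr !traceD trace_kerdock_polar zz.
by ring.
Qed.

Lemma kerdock_vec_sqr a u w : kerdock_vec a u w ^+ 2 = 1.
Proof. exact: chi_sqr. Qed.

(** All vectors agree at the origin, so they are unbiased to the corresponding
    standard basis vector, without any change of sign. *)
Lemma kerdock_vec0 a u : kerdock_vec a u 0 = 1.
Proof.
rewrite /kerdock_vec /pairing /= !mulr0 !addr0 /kerdock_form big1 ?chi0 //.
by move=> k _; rewrite expr0n.
Qed.

Lemma addr_pchar2_eq0 (x y : F) : (x + y == 0) = (x == y).
Proof. by rewrite -{1}[y](oppr_pchar2 F2) subr_eq0. Qed.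

(** If [h] is in the radical of the polar form of [Q_a + Q_b], then [a h.1] and
    [b h.1] have the same trace [tau], and cancelling [a + b] leaves
    [(a + b) h.1 = tau + h.2] in the prime field.  This element has trace [0],
    and is its own trace, so it vanishes, and then [h] does. *)
Lemma kerdock_nondegenerate a b h : a != b -> h != 0 ->
  (polar_dual a h + polar_dual b h != 0) || (trace (a * h.1 + b * h.1) != 0).
Proof.
move=> ab; apply: contraNT; rewrite negb_or !negbK => /andP[/eqP rab].
move=> tab; have tE : trace (b * h.1) = trace (a * h.1).
  by apply/eqP; rewrite eq_sym -addr_pchar2_eq0 -traceD.
pose s := trace (a * h.1) + h.2%:R.
have ab0 : a + b != 0 by rewrite addr_pchar2_eq0.
have /eqP : (a + b) * ((a + b) * h.1 + s) = 0.
  rewrite -rab /polar_dual tE /s -[RHS]addr0.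
  rewrite -(addrr_pchar2 F2 (a * b * h.1)); ring.
rewrite mulf_eq0 (negPf ab0) addr_pchar2_eq0 => /eqP sE.
have s0 : s = 0.
  rewrite -(trace_fixed (s := s)) -?sE ?mulrDl; first exact/eqP.
  by rewrite -mulrDl sE /s (pow2_expD 1) sqr_trace bool_sqr.
have h1 : h.1 = 0.
  by apply/eqP; move/eqP: sE; rewrite s0 mulf_eq0 (negPf ab0).
have h2 : h.2%:R = 0 :> F by rewrite -s0 /s h1 mulr0 trace0 add0r.
apply/eqP; case: h h1 h2 {rab tab tE s sE s0} => h1 [] /= -> //.
by move/eqP; rewrite oner_eq0.
Qed.

Lemma kerdock_vec_orthogonal a u v : u != v ->
  \sum_w kerdock_vec a u w * kerdock_vec a v w = 0.
Proof.
move=> uv; rewrite -[RHS](sum_chi_pairing (p := u.1 + v.1)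
  (t := u.2%:R + v.2%:R)).
  apply: eq_bigr => w _; rewrite /kerdock_vec -chiD; apply: eq_chi.
  set q := kerdock_form _ + _.
  have -> : q + pairing u.1 u.2%:R w + (q + pairing v.1 v.2%:R w) =
    (q + q) + pairing (u.1 + v.1) (u.2%:R + v.2%:R) w.
    by rewrite /pairing; ring.
  by rewrite addrr_pchar2 // add0r.
apply: contraNT uv; rewrite negb_or !negbK addr_pchar2_eq0 => /andP[/eqP].
case: u v => u1 u2 [v1 v2] /= ->; rewrite -natr_addb.
by rewrite trace_fixed ?bool_sqr //; case: u2 v2 => -[]; rewrite // oner_eq0.
Qed.

(** The classical evaluation of a Gauss sum: the square is a double sum over [w]
    and [w + h], whose inner sum over [w] is a character sum, and vanishes by
    nondegeneracy unless [h = 0]. *)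
Lemma kerdock_vec_unbiased a b u v : a != b ->
  (\sum_w kerdock_vec a u w * kerdock_vec b v w) ^+ 2 = #|{: V}|%:R.
Proof.
move=> ab; pose phi w := kerdock_vec a u w * kerdock_vec b v w.
pose beta h := pairing (polar_dual a h + polar_dual b h) (a * h.1 + b * h.1).
have phiD w h : phi w * phi (w + h) = phi h * chi (beta h w).
  have -> : beta h w = pairing (polar_dual a h) (a * h.1) w
                     + pairing (polar_dual b h) (b * h.1) w.
    by rewrite /beta /pairing; ring.
  rewrite /phi !kerdock_vecD chiD.
  have := kerdock_vec_sqr a u w; have := kerdock_vec_sqr b v w.
  move: (kerdock_vec a u w) (kerdock_vec b v w) => x y y2 x2.
  transitivity (x ^+ 2 * y ^+ 2 * (kerdock_vec a u h * kerdock_vec b v h *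
    (chi (pairing (polar_dual a h) (a * h.1) w) *
     chi (pairing (polar_dual b h) (b * h.1) w)))); first by ring.
  by rewrite x2 y2 !mul1r.
rewrite expr2 mulr_suml.
transitivity (\sum_w \sum_h phi h * chi (beta h w)).
  apply: eq_bigr => w _; rewrite mulr_sumr (reindex_inj (addrI w)) /=.
  by apply: eq_bigr => h _; apply: phiD.
rewrite exchange_big (bigD1 (0 : V)) //= [X in _ + X]big1 => [|h h0];
  last first.
  by rewrite -mulr_sumr sum_chi_pairing ?mulr0 // kerdock_nondegenerate.
rewrite addr0 (eq_bigr (fun=> 1)) ?sumr_const // => w _.
rewrite /phi !kerdock_vec0 /beta /pairing /polar_dual /=.
by rewrite !mulr0 !trace0 !addr0 !mulr0 !mul0r !addr0 mul0r chi0 !mul1r.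
Qed.

End Trace.

(** * Equiangular lines from Gram matrices *)

(** Unnormalized vectors indexed by finite types are easier to construct; the
    subset [A] of coordinates makes it possible to drop some of them.  The lines
    are distinct because [g < N]. *)
Lemma has_equiangular_gram (R : realType) (K T : finType) (A : {pred T})
    (f : K -> T -> R) (N g : R) (d n : nat) :
    0 <= g -> g < N ->
    (forall k, \sum_(t in A) f k t * f k t = N) ->
    (forall k l, k != l -> (\sum_(t in A) f k t * f l t) ^+ 2 = g ^+ 2) ->
  (#|A| <= d)%N -> (n <= #|K|)%N -> has_equiangular R d n.
Proof.
move=> g0 gN fN fg /subnKC <- nK; apply/asboolP.
have N0 : 0 < N by apply: le_lt_trans gN.
pose k (i : 'I_n) : K := enum_val (widen_ord nK i).
have k_inj : injective k by move=> i j /enum_val_inj/(congr1 val)/= /val_inj.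
pose v (i : 'I_n) : 'rV[R]_(#|A| + (d - #|A|)) :=
  row_mx (\row_c (f (k i) (enum_val c) / Num.sqrt N)) 0.
have dotv i j : dot (v i) (v j) = (\sum_(t in A) f (k i) t * f (k j) t) / N.
  rewrite /dot big_split_ord /= [X in _ + X]big1 => [|c _]; last first.
    by rewrite !row_mxEr mxE mul0r.
  rewrite addr0 [in RHS]big_enum_val mulr_suml; apply: eq_bigr => c _.
  rewrite !row_mxEl !mxE mulrACA -invfM -expr2 sqr_sqrtr //.
  exact: ltW.
have gN1 : g / N < 1 by rewrite ltr_pdivrMr // mul1r.
have dotv_ne i j : i != j ->
    dot (v i) (v j) = g / N \/ dot (v i) (v j) = - (g / N).
  move=> ij; rewrite dotv; have := fg (k i) (k j).
  rewrite (inj_eq k_inj) => /(_ ij) /eqP; rewrite eqf_sqr.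
  by case/orP => /eqP ->; rewrite ?mulNr; [left | right].
have dotv1 i : dot (v i) (v i) = 1 by rewrite dotv fN divff // gt_eqF.
exists v; split=> //.
- move=> i j vij; apply/eqP; apply: contraT => ij; move: (dotv_ne _ _ ij).
  have /vlineP[a va] : v i \in <[v j]>%VS by rewrite -vij memv_line.
  have dva w : dot (v i) w = a * dot (v j) w.
    by rewrite va /dot mulr_sumr; apply: eq_bigr => c _; rewrite mxE mulrA.
  have := dotv1 i; rewrite dva dotC dva !dotv1 mulr1 => aa.
  have gN0 : 0 <= g / N by rewrite divr_ge0 // ltW.
  by case=> aE; move: aa; rewrite aE; nra.
- exists (g / N) => [|i j ij]; first by rewrite divr_ge0 // ltW.
  by apply: dotv_ne; rewrite -(inj_eq val_inj) /= neq_ltn ij.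
Qed.

Lemma has_equiangular_le_max (R : realType) (d n : nat) :
  has_equiangular R d n -> (n <= max_equiangular R d)%N.
Proof. by rewrite /max_equiangular; case: ex_maxnP => m _; apply. Qed.

Lemma has_equiangular_orthonormal (R : realType) (d : nat) :
  has_equiangular R d d.
Proof.
apply: (@has_equiangular_gram R 'I_d 'I_d predT
  (fun i j => (i == j)%:R) 1 0) => [||i|i j /negPf ij||]; rewrite ?card_ord //.
- rewrite (bigD1 i) //= eqxx mulr1 big1 ?addr0 // => j /negPf ji.
  by rewrite eq_sym ji mulr0.
- rewrite big1 // => l _; case: (i =P l) => [<-|_]; rewrite ?mul0r //.
  by rewrite eq_sym ij mulr0.
Qed.

(** * Equiangular lines from mutually unbiased bases *)

Section Augmentation.

Variables (R : realType) (J V : finType) (f : J -> V -> V -> R) (s : R).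
Hypothesis s_gt0 : 0 < s.
Hypothesis orthogonal_basis : forall a u v,
  \sum_w f a u w * f a v w = s ^+ 2 * (u == v)%:R.
Hypothesis unbiased : forall a b u v, a != b ->
  (\sum_w f a u w * f b v w) ^+ 2 = s ^+ 2.

(** The part added to the vectors of basis [a] is [c e_a + beta 1].  The shift
    by [beta] compensates for a coordinate that is dropped from the first
    part. *)
Definition augment (c beta : R) (p : J * V) (t : V + J) : R :=
  match t with
  | inl w => f p.1 p.2 w
  | inr b => c * (b == p.1)%:R + beta
  end.

Lemma augment_gram c beta p q :
  \sum_t augment c beta p t * augment c beta q t =
  \sum_w f p.1 p.2 w * f q.1 q.2 w + c ^+ 2 * (p.1 == q.1)%:R
    + (2 * c * beta + #|J|%:R * beta ^+ 2).
Proof.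
have delta (a : J) (F : J -> R) : \sum_b (b == a)%:R * F b = F a.
  rewrite (bigD1 a) //= eqxx mul1r big1 ?addr0 // => b /negPf ->.
  by rewrite mul0r.
rewrite big_sumType /= -addrA; congr (_ + _).
transitivity (\sum_b ((b == p.1)%:R * (c ^+ 2 * (b == q.1)%:R + c * beta)
    + (b == q.1)%:R * (c * beta) + beta ^+ 2)).
  by apply: eq_bigr => b _; ring.
rewrite !big_split /= !delta sumr_const -mulr_natl cardT -cardE.
by ring.
Qed.

Lemma off_diagonal p q : p != q ->
  (\sum_w f p.1 p.2 w * f q.1 q.2 w + s * (p.1 == q.1)%:R) ^+ 2 = s ^+ 2.
Proof.
case: p q => a u [b v]; rewrite -pair_eqE /pair_eq /=.
have [<-|ab _] := eqVneq a b; last by rewrite mulr0 addr0 unbiased.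
by move=> /= /negPf uv; rewrite orthogonal_basis uv mulr0 add0r mulr1.
Qed.

Lemma diagonal p :
  \sum_w f p.1 p.2 w * f p.1 p.2 w + s * (p.1 == p.1)%:R = s ^+ 2 + s.
Proof. by rewrite orthogonal_basis !eqxx !mulr1. Qed.

Lemma equiangular_of_mub d : (#|V| + #|J| <= d)%N ->
  has_equiangular R d (#|J| * #|V|).
Proof.
move=> dVJ.
have gram p q : \sum_(t in predT)
    augment (Num.sqrt s) 0 p t * augment (Num.sqrt s) 0 q t =
  \sum_w f p.1 p.2 w * f q.1 q.2 w + s * (p.1 == q.1)%:R.
  by rewrite augment_gram sqr_sqrtr 1?ltW //; ring.
apply: (@has_equiangular_gram _ _ _ predT
  (augment (Num.sqrt s) 0) (s ^+ 2 + s) s).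
- exact: ltW.
- by rewrite ltrDr exprn_gt0.
- by move=> p; rewrite gram diagonal.
- by move=> p q pq; rewrite gram off_diagonal.
- by rewrite cardE -cardT card_sum.
- by rewrite card_prod.
Qed.

(** The coordinate [w0] contributes [1] to every inner product.  It can be
    removed if the added parts make up for it, that is, if their Gram matrix is
    [s I + 1 1^T] instead of [s I]; this gives a quadratic equation for
    [beta]. *)
Lemma equiangular_of_mub_codim1 (w0 : V) d : (0 < #|J|)%N ->
    (forall a u, f a u w0 = 1) -> (#|V| + #|J| <= d.+1)%N ->
  has_equiangular R d (#|J| * #|V|).
Proof.
move=> J0 f1 dVJ; pose c := Num.sqrt s.
have c2 : c ^+ 2 = s by rewrite sqr_sqrtr // ltW.
pose j : R := #|J|%:R; have j0 : j != 0 by rewrite pnatr_eq0 -lt0n.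
pose beta := (Num.sqrt (s + j) - c) / j.
have betaE : 2 * c * beta + j * beta ^+ 2 = 1.
  have : Num.sqrt (s + j) ^+ 2 = s + j by rewrite sqr_sqrtr // addr_ge0 // ltW.
  have -> : Num.sqrt (s + j) = j * beta + c.
    by rewrite /beta mulrC divfK // subrK.
  rewrite -c2 => E; apply: (mulfI j0); apply: (addrI (c ^+ 2)).
  by rewrite mulr1 -E; ring.
have gram p q :
    \sum_(t in predC1 (inl w0)) augment c beta p t * augment c beta q t
    = \sum_w f p.1 p.2 w * f q.1 q.2 w + s * (p.1 == q.1)%:R.
  apply: (addrI 1); rewrite -{1}[1](mulr1 1) -{1}(f1 p.1 p.2) -{1}(f1 q.1 q.2).
  have := augment_gram c beta p q; rewrite (bigD1 (inl w0)) //= => ->.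
  by rewrite betaE c2 addrC.
apply: (@has_equiangular_gram _ _ _ (predC1 (inl w0))
  (augment c beta) (s ^+ 2 + s) s).
- exact: ltW.
- by rewrite ltrDr exprn_gt0.
- by move=> p; rewrite gram diagonal.
- by move=> p q pq; rewrite gram off_diagonal.
- by rewrite cardC1 card_sum -subn1 leq_subLR add1n.
- by rewrite card_prod.
Qed.

End Augmentation.

(** * Lines from the Kerdock bases *)

Section KerdockLines.

Variables (R : realType) (r : nat).

Lemma pow4E : (2 ^ r.*2.+1 * 2 = 2 ^ r.+1 * 2 ^ r.+1)%N.
Proof. by rewrite -expnSr -expnD addSn addnS addnn. Qed.

Lemma kerdock_lines_codim1 j d : (0 < j)%N -> (j <= 2 ^ r.*2.+1)%N ->
  (2 ^ r.*2.+1 * 2 + j <= d.+1)%N ->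
  has_equiangular R d (j * (2 ^ r.*2.+1 * 2)).
Proof.
move=> j0 jq dj; have [F F2 cardF] := @pPrimePowerField 2 r.*2.+1 isT isT.
have cardV : #|{: F * bool}| = (2 ^ r.*2.+1 * 2)%N.
  by rewrite card_prod cardF card_bool.
have jF : (j <= #|F|)%N by rewrite cardF.
pose e (i : 'I_j) : F := enum_val (widen_ord jF i).
have e_inj : injective e by move=> a b /enum_val_inj/(congr1 val)/= /val_inj.
have s2 : #|{: F * bool}|%:R = (2 ^ r.+1)%:R ^+ 2 :> R.
  by rewrite cardV pow4E natrM expr2.
rewrite -cardV -[X in (X * _)%N](card_ord j).
apply: (@equiangular_of_mub_codim1 R 'I_j _
  (fun a => kerdock_vec r R (e a)) (2 ^ r.+1)%:R _ _ _ (0 : F * bool)).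
- by rewrite ltr0n expn_gt0.
- move=> a u v; have [<-|uv] := eqVneq u v.
    rewrite (eq_bigr (fun=> 1)) ?sumr_const ?s2 ?mulr1 // => w _.
    by rewrite -expr2 kerdock_vec_sqr.
  by rewrite mulr0 kerdock_vec_orthogonal.
- by move=> a b u v ab; rewrite kerdock_vec_unbiased ?(inj_eq e_inj).
- by rewrite card_ord.
- by move=> a u; rewrite kerdock_vec0.
- by rewrite card_ord cardV.
Qed.

(** The standard basis, scaled by [s] to have the same norm as the sign vectors,
    is unbiased to all of them because their entries are [+/- 1]. *)
Lemma kerdock_lines_full d : (2 ^ r.*2.+1 * 2 + (2 ^ r.*2.+1).+1 <= d)%N ->
  has_equiangular R d ((2 ^ r.*2.+1).+1 * (2 ^ r.*2.+1 * 2)).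
Proof.
have [F F2 cardF] := @pPrimePowerField 2 r.*2.+1 isT isT => dq.
have cardV : #|{: F * bool}| = (2 ^ r.*2.+1 * 2)%N.
  by rewrite card_prod cardF card_bool.
have cardJ : #|{: option F}| = (2 ^ r.*2.+1).+1 by rewrite card_option cardF.
have s2 : #|{: F * bool}|%:R = (2 ^ r.+1)%:R ^+ 2 :> R.
  by rewrite cardV pow4E natrM expr2.
pose s : R := (2 ^ r.+1)%:R.
pose f (a : option F) (u w : F * bool) : R :=
  if a is Some x then kerdock_vec r R x u w else s * (w == u)%:R.
have delta u (g : F * bool -> R) :
    \sum_w s * (w == u)%:R * g w = s * g u.
  rewrite (bigD1 u) //= eqxx mulr1 big1 ?addr0 // => w /negPf ->.
  by rewrite mulr0 mul0r.
rewrite -cardV -cardJ.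
apply: (@equiangular_of_mub R _ _ f s).
- by rewrite ltr0n expn_gt0.
- move=> [a|] u v /=; last by rewrite delta expr2 mulrA.
  have [<-|uv] := eqVneq u v; last by rewrite mulr0 kerdock_vec_orthogonal.
  rewrite (eq_bigr (fun=> 1)) ?sumr_const ?s2 ?mulr1 // => w _.
  by rewrite -expr2 kerdock_vec_sqr.
- move=> [a|] [b|] u v //= ab.
  + by rewrite kerdock_vec_unbiased.
  + under eq_bigr do rewrite mulrC.
    by rewrite delta exprMn (kerdock_vec_sqr F2 cardF) mulr1.
  + by rewrite delta exprMn (kerdock_vec_sqr F2 cardF) mulr1.
- by rewrite cardV cardJ.
Qed.

End KerdockLines.

(** * Counting *)

(** With [d = M + j - 1], the right side minus the left side is concave in [j],
    so it is positive on the whole range [M / 32 + 1 <= j <= M / 2] because it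
    is at both ends; this range is what the two bounds on [d] and [j] mean. *)
Lemma codim1_count (R : realFieldType) (M j d : R) :
    0 <= M -> d + 1 = M + j -> 33 * M <= 32 * d -> 2 * j <= M ->
  32 * d ^+ 2 + 328 * d + 296 <= 1089 * (j * M).
Proof.
move=> M0 dE dM jM; have {}dE : d = M + j - 1 by lra.
have j_lo : 0 <= 32 * j - M - 32 by lra.
have j_hi : 0 <= M - 2 * j by lra.
have M2 : 0 <= M - 2 by lra.
rewrite dE; have := mulr_ge0 j_lo j_hi; have := mulr_ge0 j_lo M0.
have := mulr_ge0 M0 M2; lra.
Qed.

Theorem corollary2p8 (R : realType) (d : nat) (hd : (2 <= d)%N) :
  Num.ceil (1 / 1089 * (32 * d%:R ^+ 2 + 328 * d%:R + 296) : R)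
    <= (max_equiangular R d)%:Z.
Proof.
suff [n lines count] : exists2 n, has_equiangular R d n &
    32 * d%:R ^+ 2 + 328 * d%:R + 296 <= 1089 * n%:R :> R.
  apply: le_trans (_ : n%:Z <= _); last first.
    by rewrite lez_nat has_equiangular_le_max.
  rewrite ceil_le_int -[n%:~R]/(n%:R : R); lra.
have [d23|d24] := leqP d 23.
  exists d; first exact: has_equiangular_orthonormal.
  have d2R : 2 <= d%:R :> R by rewrite (ler_nat R 2).
  have d23R : d%:R <= 23 :> R by rewrite (ler_nat R d 23).
  nra.
(* The power of four with [33 M <= 32 d < 132 M]; it is at least 16 because
   [24 <= d], and so [M / 8] is an integer. *)
have [/andP[Mlo Mhi] k2] :
    (4 ^ trunc_log 4 (32 * d %/ 33) <= 32 * d %/ 33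
       < 4 ^ (trunc_log 4 (32 * d %/ 33)).+1)%N /\
    (1 < trunc_log 4 (32 * d %/ 33))%N.
  have x23 : (16 <= 32 * d %/ 33)%N by lia.
  by split; [apply: trunc_log_bounds; lia | apply: trunc_log_max].
move: (trunc_log _ _) k2 Mlo Mhi => [|[|r]] // _.
rewrite (expnS 4 r.+2); have -> : (4 ^ r.+2 = 2 ^ r.+1.*2.+1 * 2)%N.
  by rewrite -expnSr -doubleS -mul2n expnM.
(* Here [q = M / 2]; divisibility by 4 sharpens [8 d < 33 M] to
   [8 (d + 1) <= 33 M], where equality can occur. *)
have q4 : (2 ^ r.+1.*2.+1 = 4 * (2 ^ r.*2.+1))%N by rewrite !expnS mulnA.
have q0 : (0 < 2 ^ r.*2.+1)%N by rewrite expn_gt0.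
have codim1 := @kerdock_lines_codim1 R r.+1.
have full := @kerdock_lines_full R r.+1.
move: (2 ^ r.+1.*2.+1)%N (2 ^ r.*2.+1)%N q4 q0 codim1 full.
move=> q q' q4 q0 codim1 full Mlo Mhi.
have q1R : 1 <= q%:R :> R by rewrite (ler_nat R 1); lia.
have [short|] := leqP d.+1 (q * 2 + q).
  exists ((d.+1 - q * 2) * (q * 2))%N; first by apply: codim1; lia.
  rewrite natrM; apply: codim1_count; rewrite ?ler0n //.
  - by rewrite natr1 -natrD; congr _%:R; lia.
  - by rewrite -!natrM ler_nat; lia.
  - by rewrite -!natrM ler_nat; lia.
rewrite ltnS leq_eqVlt => /orP[/eqP dE|long].
  exists (q * (q * 2))%N; first by apply: codim1; lia.
  have dR : d%:R = 3 * q%:R :> R by rewrite -natrM; congr _%:R; lia.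
  by rewrite dR (natrM _ q) (natrM _ q 2); nra.
exists (q.+1 * (q * 2))%N; first by apply: full; lia.
have hi : 4 * (d%:R + 1) <= 33 * q%:R :> R.
  by rewrite natr1 -!natrM ler_nat; lia.
have gap : 0 <= 33 * q%:R - 4 * (d%:R + 1) :> R by lra.
have d0 : 0 <= d%:R :> R by [].
have sum0 : 0 <= 33 * q%:R + 4 * (d%:R + 1) + 33 :> R by lra.
rewrite (natrM _ q.+1) (natrM _ q 2) -natr1; have := mulr_ge0 gap sum0; lra.
Qed.
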